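(* Suppose that $f:[0,1]\to[0,1]$ is a polynomial function with constant degree, $p=\omega(\log n/n)$ and $q\ge \log n/n^2$. Then $G(2n,p,q)$ is $f$-good w.h.p.
   Context: Stochastic block model: for $n\in\mathbb N$ and $p,q\in[0,1]$ with $q\le p$, $G(2n,p,q)$ is the random graph on $V=V_1\cup V_2$, $|V_1|=|V_2|=n$, $V_1\cap V_2=\emptyset$, in which each pair of distinct vertices $u\in V_i$, $v\in V_j$ forms an edge independently with probability $p$ if $i=j$ and $q$ if $i\ne j$. Here $p=p(n)$, $q=q(n)$. Notation: $\deg(v)$ is the degree of $v$, $\deg_A(v)$ the number of neighbors of $v$ in $A\subseteq V$, and $A_i=A\cap V_i$. $f$-good: for a function $f:[0,1]\to[0,1]$, $G(2n,p,q)$ is $f$-good if it satisfies: (P1) it is connected and non-bipartite; (P2) a positive constant $C_1$ exists such that for all $A,S\subseteq V$ and $i\in\{1,2\}$, $$\left|\sum_{v\in S\cap V_i} f\left(\frac{\deg_A(v)}{\deg(v)}\right)-|S\cap V_i|\,f\left(\frac{|A_i|p+|A_{3-i}|q}{n(p+q)}\right)\right|\le C_1\sqrt{\frac np};$$ (P3) a positive constant $C_2$ exists such that for all $A\subseteq V$, $S\in\{A,V\setminus A,V\}$ and $i\in\{1,2\}$, $$\sum_{v\in S\cap V_i} f\left(\frac{\deg_A(v)}{\deg(v)}\right)\le |S\cap V_i|\,f\left(\frac{|A_i|p+|A_{3-i}|q}{n(p+q)}\right)+C_2|A|\sqrt{\frac{\log n}{np}}.$$ Asymptotics are as $n\to\infty$;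 ''constant'' means independent of $n$ (so $C_1,C_2$ do not depend on $n$, $A$, $S$). ''W.h.p.'' means with probability at least $1-n^{-c}$ for some constant $c>0$. *)

(* Defs.v *)
From HB Require Import structures.
From mathcomp Require Import all_boot all_order all_algebra.
From mathcomp Require Import all_classical all_reals all_analysis.

Set Implicit Arguments.
Unset Strict Implicit.
Unset Printing Implicit Defensive.

Import Order.TTheory GRing.Theory Num.Theory.
Import numFieldNormedType.Exports.

Local Open Scope ring_scope.

(* V = V_1 :|: V_2 is encoded by tagging: the two indices i of the blocks are
   the booleans, and 3 - i is ~~ i. *)
Notation vertex n := (bool * 'I_n)%type.

Definition block (n : nat) (i : bool) : {set vertex n} :=
  [set v : vertex n | v.1 == i]%SET.

Definition pairs (n : nat) : {set {set vertex n}} :=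
  [set e : {set vertex n} | #|e| == 2]%SET.

(* A simple graph is given by its edge set, a subset of [pairs n]. *)
Notation graph n := {set {set vertex n}}.

Definition adj (n : nat) (G : graph n) : rel (vertex n) :=
  fun u v => [set u; v]%SET \in G.

Definition deg_in (n : nat) (G : graph n) (A : {set vertex n}) (v : vertex n) :
    nat :=
  #|[set u in A | adj G v u]%SET|.

Definition deg (n : nat) (G : graph n) (v : vertex n) : nat :=
  deg_in G [set: vertex n]%SET v.

Definition connected_graph (n : nat) (G : graph n) : Prop :=
  forall u v : vertex n, connect (adj G) u v.

Definition bipartite (n : nat) (G : graph n) : Prop :=
  exists X : {set vertex n},
    forall u v : vertex n, adj G u v -> (u \in X) != (v \in X).

Section StochasticBlockModel.
Variables (R : realType) (n : nat) (p q : R).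

Definition edge_prob (e : {set vertex n}) : R :=
  if [exists i : bool, e \subset block n i] then p else q.

Definition sbm_weight (G : graph n) : R :=
  \prod_(e in pairs n) (if e \in G then edge_prob e else 1 - edge_prob e).

(* The probability that G(2n,p,q) has the property E. *)
Definition sbm_pr (E : graph n -> Prop) : R :=
  \sum_(G : graph n | (G \subset pairs n) && `[< E G >]) sbm_weight G.

Lemma sbm_pr_total : sbm_pr (fun=> True) = 1.
Proof.
pose a (e : {set vertex n}) := if e \in pairs n then edge_prob e else 0.
pose b (e : {set vertex n}) := if e \in pairs n then 1 - edge_prob e else 1.
have ab e : a e + b e = 1 by rewrite /a /b; case: ifP => _; rewrite ?subrKC ?add0r.
have <- : \prod_e (a e + b e) = 1 by apply: big1 => e _; exact: ab.
rewrite bigA_distr /sbm_pr big_mkcond /=; apply: eq_bigr => G _.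
rewrite asboolT// andbT; case: ifPn => [/fintype.subsetP GP|].
  rewrite /sbm_weight big_mkcond /=; apply: eq_bigr => e _; rewrite /a /b.
  by case: (boolP (e \in pairs n)) => // eP; case: ifPn => // /GP; rewrite (negbTE eP).
case/fintype.subsetPn => e eG eP.
by rewrite (bigD1 e)//= eG /a (negbTE eP) mul0r.
Qed.

Variables (f : R -> R) (C1 C2 : R) (G : graph n).

(* The term of v in the sums of [P2] and [P3].  The quotient is 0 for an
   isolated v, a case which [P1] excludes when n > 0. *)
Definition f_frac (A : {set vertex n}) (v : vertex n) : R :=
  f ((deg_in G A v)%:R / (deg G v)%:R).

Definition f_mean (A : {set vertex n}) (i : bool) : R :=
  f ((#|A :&: block n i|%:R * p + #|A :&: block n (~~ i)|%:R * q)
     / (n%:R * (p + q))).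

Definition P1 : Prop := connected_graph G /\ ~ bipartite G.

Definition P2 : Prop :=
  forall (A S : {set vertex n}) (i : bool),
    `| \sum_(v in S :&: block n i) f_frac A v
       - #|S :&: block n i|%:R * f_mean A i | <= C1 * Num.sqrt (n%:R / p).

Definition P3 : Prop :=
  forall (A S : {set vertex n}) (i : bool),
    S \in [:: A; ~: A; [set: vertex n]]%SET ->
    \sum_(v in S :&: block n i) f_frac A v
      <= #|S :&: block n i|%:R * f_mean A i
         + C2 * #|A|%:R * Num.sqrt (ln n%:R / (n%:R * p)).

Definition f_good : Prop := [/\ P1, P2 & P3].

End StochasticBlockModel.

(* [pr n] is the probability of the n-th event of a sequence of events. *)
Definition whp (R : realType) (pr : nat -> R) : Prop :=
  exists2 c : R, 0 < c &
    \forall n \near \oo%classic, 1 - n%:R `^ (- c) <= pr n.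

(* Main.v *)
Require Import Defs.
From mathcomp Require Import all_boot all_order all_algebra.
From mathcomp Require Import all_classical all_reals all_analysis.
From mathcomp Require Import ring lra.
Set Implicit Arguments.
Unset Strict Implicit.
Unset Printing Implicit Defensive.
Import Order.TTheory GRing.Theory Num.Theory.
Import numFieldNormedType.Exports.
Local Open Scope classical_set_scope.
Local Open Scope ring_scope.

(** Write [L = ln n] and [D = n p], so that [D / L] tends to infinity, and let
    [mean_deg A i] be the numerator in the argument of [f_mean], which is the
    expected number of neighbours in [A] of a vertex of block [i] up to the
    contribution of a loop.  Everything follows from four properties, together
    called [quasirandom], that hold with probability [1 - O(1/n)]:

    - for all vertex sets [S] and [A], the number of edges from [S] to [A]
      differs from its mean by [O(max(|S|,|A|) sqrt(D L))];
    - the same difference is always [O(n sqrt D)];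
    - the degree of every vertex into each block is within [O(sqrt(D L))] of
      its mean;
    - some edge joins the two blocks.

    The first three are exponential moment bounds ([edges_tail]) summed over
    all sets: the failure probability for [S] and [A] decays like
    [n^-(|S|+|A|)] in the first case and faster than the number of pairs
    [(S, A)] in the second.  The last one is where [q >= ln n / n^2] enters.

    For a quasirandom graph the rest is deterministic.

    (P1) A set of at most half of a block sends an edge to the rest of the
    block, since its vertices have degree about [D] into the block and the
    set itself can absorb only about half of these edges; hence each block is
    connected, and the fourth property joins the two blocks.  A set of at least half of a block spans an edge, so no
    2-colouring exists.

    (P2) Let [x_v = deg_A(v) / deg(v)] and [m] its reference value.  Then
    [|x_v - m|] is at most the sum of the deviations of [deg_A(v)] and [deg(v)]
    divided by [D] ([norm_frac_dev]).  Summing absolute deviations costs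
    a factor 2 only, by separating the two signs ([sum_dev_le]), so that the
    second property and the Lipschitz continuity of [f] give the bound.

    (P3) For [S = A] the first property replaces the second one.  For
    [S = V] an absolute value inside the sum would be too expensive; instead
    [f] is expanded to second order at [m].  The linear term is small
    because, by double counting, the sum of [deg_A(v)] over a block is the sum
    over [A] of degrees into that block ([sum_frac_dev_block]).  The quadratic
    term is small because the set of [v] where [|x_v - m|] exceeds
    [theta = O(sqrt(L / D))] has fewer than [|A|] elements, by the first
    property ([sum_frac_dev_sqr]).  The case of the complement of [A] is the
    difference of these two. *)

(** * Probabilities in the stochastic block model *)

Section Probability.
Variables (R : realType) (n : nat) (p q : R).
Hypotheses (q_ge0 : 0 <= q) (le_qp : q <= p) (p_le1 : p <= 1).
Implicit Types (G : graph n) (E F : graph n -> Prop) (S A : {set vertex n}).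

Local Notation pr := (@sbm_pr R n p q).
Local Notation prob := (@edge_prob R n p q).

Lemma edge_prob_ge0 e : 0 <= prob e.
Proof. by rewrite /edge_prob; case: ifP => // _; apply: le_trans le_qp. Qed.

Lemma edge_prob_lep e : prob e <= p.
Proof. by rewrite /edge_prob; case: ifP. Qed.

Lemma sbm_weight_ge0 G : 0 <= sbm_weight p q G.
Proof.
apply: prodr_ge0 => e _; case: ifP => _; first exact: edge_prob_ge0.
by rewrite subr_ge0 (le_trans (edge_prob_lep e)).
Qed.

Lemma sbm_pr_le E F :
  (forall G, G \subset pairs n -> E G -> F G) -> pr E <= pr F.
Proof.
move=> EF; rewrite /sbm_pr [leLHS]big_mkcond [leRHS]big_mkcond.
apply: ler_sum => G _; case: ifPn => [/andP[GP /asboolP EG]|_].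
  by rewrite GP asboolT //; apply: EF.
by case: ifP => _ //; exact: sbm_weight_ge0.
Qed.

Lemma sbm_pr_not E : pr E = 1 - pr (fun G => ~ E G).
Proof.
apply/eqP; rewrite eq_sym subr_eq -(sbm_pr_total n p q) /sbm_pr.
rewrite [X in X == _](bigID (fun G => `[< E G >])) /=.
apply/eqP; congr (_ + _); apply: eq_bigl => G.
  by rewrite (@asboolT True) // andbT.
by rewrite (@asboolT True) // andbT asbool_neg.
Qed.

Lemma sbm_pr_exists (T : finType) (E : T -> graph n -> Prop) :
  pr (fun G => exists x, E x G) <= \sum_x pr (E x).
Proof.
rewrite /sbm_pr; under [leRHS]eq_bigr => x _ do rewrite big_mkcond.
rewrite exchange_big [leLHS]big_mkcond; apply: ler_sum => G _.
have wG := sbm_weight_ge0 G.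
case: ifPn => [/andP[GP /asboolP[x ExG]]|_]; last first.
  by apply: sumr_ge0 => x _; case: ifP.
by rewrite (bigD1 x) //= GP asboolT //= lerDl; apply: sumr_ge0 => y _; case: ifP.
Qed.

Lemma sbm_pr_or E F : pr (fun G => E G \/ F G) <= pr E + pr F.
Proof.
have -> : pr E + pr F = \sum_b pr (if b then E else F) by rewrite big_bool.
apply: le_trans (sbm_pr_exists _); apply: sbm_pr_le => G _ [EG|FG].
  by exists true.
by exists false.
Qed.

(** Independence of the edges: both sides expand to the same sum over edge
    sets. *)
Lemma sbm_expect_prod (a : {set vertex n} -> R) :
  \sum_(G : graph n | G \subset pairs n) sbm_weight p q G * \prod_(e in G) a e
  = \prod_(e in pairs n) (1 + prob e * (a e - 1)).
Proof.
pose x e := if e \in pairs n then prob e * a e else 0.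
pose y e := if e \in pairs n then 1 - prob e else 1.
transitivity (\prod_e (x e + y e)); last first.
  rewrite [RHS]big_mkcond; apply: eq_bigr => e _; rewrite /x /y.
  by case: ifP => _; ring.
rewrite bigA_distr big_mkcond; apply: eq_bigr => G _.
case: ifPn => [/fintype.subsetP GP|]; last first.
  by case/fintype.subsetPn => e eG eP; rewrite (bigD1 e) //= eG /x (negbTE eP) mul0r.
rewrite /sbm_weight big_mkcond [X in _ * X]big_mkcond -big_split.
apply: eq_bigr => e _; rewrite /x /y /=.
have := GP e; case: (e \in G) => [->//|_].
by rewrite mulr1.
Qed.

(** Markov's inequality for a product of edge factors.  With [a] an exponential
    it is a Chernoff bound; with [a] vanishing on some pairs it bounds the
    probability that none of these is an edge. *)
Lemma sbm_pr_markov E (a : {set vertex n} -> R) (c : R) :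
    0 < c -> (forall e, 0 <= a e) ->
    (forall G, G \subset pairs n -> E G -> c <= \prod_(e in G) a e) ->
  pr E <= c^-1 * expR (\sum_(e in pairs n) prob e * (a e - 1)).
Proof.
move=> c_gt0 a_ge0 Ec; rewrite -ler_pdivrMl ?invr_gt0// invrK.
have step : c * pr E <=
    \sum_(G : graph n | G \subset pairs n) sbm_weight p q G * \prod_(e in G) a e.
  rewrite /sbm_pr mulr_sumr big_mkcondr; apply: ler_sum => G GP.
  have wG := sbm_weight_ge0 G.
  case: ifPn => [/asboolP EG|_]; last by rewrite mulr_ge0 // prodr_ge0.
  by rewrite mulrC ler_wpM2l // Ec.
apply: le_trans step _; rewrite sbm_expect_prod expR_sum.
apply: ler_prod => e _; rewrite expR_ge1Dx andbT.
have := edge_prob_ge0 e; have := edge_prob_lep e; have := a_ge0 e.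
by have := p_le1; nra.
Qed.

End Probability.

(** * Counting edges between two sets *)

Section Counting.
Variables (R : realType) (n : nat) (p q : R).
Implicit Types (G : graph n) (S A e : {set vertex n}) (u v : vertex n).

(** Edges with both ends in [S :&: A] count twice. *)
Definition edges G S A : R := \sum_(v in S) (deg_in G A v)%:R.

Definition rate (i j : bool) : R := if i == j then p else q.

(** The expectation of [deg_in G A v] for [v] in block [i], except that when
    [v \in A] it includes the loop at [v], which never is an edge. *)
Definition mean_deg A (i : bool) : R :=
  #|A :&: block n i|%:R * p + #|A :&: block n (~~ i)|%:R * q.

(** The number of times that [edges] counts [e]. *)
Definition mult S A e : R := \sum_(v in S) \sum_(u in A) ([set v; u]%SET == e)%:R.

Lemma in_block v i : (v \in block n i) = (v.1 == i).
Proof. by rewrite inE. Qed.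

Lemma adjC G u v : adj G u v = adj G v u.
Proof. by rewrite /adj finset.setUC. Qed.

Lemma deg_inE G A v : (deg_in G A v)%:R = \sum_(u in A) (adj G v u)%:R :> R.
Proof.
rewrite /deg_in -sum1_card natr_sum big_mkcond [RHS]big_mkcond.
apply: eq_bigr => u _; rewrite inE.
by case: (u \in A) => //=; case: (adj G v u).
Qed.

Lemma edgesC G S A : edges G S A = edges G A S.
Proof.
rewrite /edges (eq_bigr _ (fun v _ => deg_inE G A v)) exchange_big.
apply: eq_bigr => u _; rewrite deg_inE; apply: eq_bigr => v _.
by rewrite adjC.
Qed.

Lemma edges_mult G S A : edges G S A = \sum_(e in G) mult S A e.
Proof.
rewrite /mult exchange_big; apply: eq_bigr => v _.
rewrite deg_inE exchange_big; apply: eq_bigr => u _.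
have [uvG|uvG] := boolP (adj G v u); last first.
  rewrite big1 // => e eG; case: eqP => // eE.
  by rewrite /adj eE eG in uvG.
rewrite (bigD1 [set v; u]%SET) //= eqxx big1 ?addr0 // => e /andP[_].
by rewrite eq_sym => /negbTE->.
Qed.

Lemma mult_ge0 S A e : 0 <= mult S A e.
Proof. by apply: sumr_ge0 => v _; apply: sumr_ge0. Qed.

(** Both ends of a counted pair range over the two elements of [e]. *)
Lemma mult_le4 S A e : e \in pairs n -> mult S A e <= 4.
Proof.
rewrite inE => /eqP e2.
have -> : 4 = \sum_(v in e) \sum_(u in e) 1 :> R.
  by rewrite !sumr_const e2 -mulrnA.
rewrite /mult big_mkcond [leRHS]big_mkcond; apply: ler_sum => v _.
have uv_le (B : {set vertex n}) : v \in e ->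
    \sum_(u in B) ([set v; u]%SET == e)%:R <= \sum_(u in e) 1 :> R.
  move=> ve; rewrite big_mkcond [leRHS]big_mkcond; apply: ler_sum => u _.
  have [ue|ue] := boolP (u \in e); first by case: ifP => _ //; case: eqP.
  by case: ifP => _ //; case: eqP => // eE; rewrite -eE !inE eqxx orbT in ue.
have [ve|ve] := boolP (v \in e).
  by case: ifP => _; [exact: uv_le | apply: sumr_ge0].
case: ifP => _ //; rewrite big1 // => u _.
by case: eqP => // eE; rewrite -eE !inE eqxx in ve.
Qed.

Lemma sum_mult (x : {set vertex n} -> R) S A :
  \sum_(e in pairs n) x e * mult S A e =
  \sum_(v in S) \sum_(u in A) (if v != u then x [set v; u]%SET else 0).
Proof.
under eq_bigr => e _ do rewrite mulr_sumr.
rewrite exchange_big; apply: eq_bigr => v _.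
under eq_bigr => e _ do rewrite mulr_sumr.
rewrite exchange_big; apply: eq_bigr => u _.
have -> : (v != u) = ([set v; u]%SET \in pairs n).
  by rewrite inE cards2; case: (v != u).
case: ifPn => [uvP|uvP]; last first.
  rewrite big1 // => e eP; case: eqP => [eE|_]; last by rewrite mulr0.
  by rewrite eE eP in uvP.
rewrite (bigD1 [set v; u]%SET) //= eqxx mulr1 big1 ?addr0 // => e /andP[_].
by rewrite eq_sym => /negbTE->; rewrite mulr0.
Qed.

Lemma sum_mult_le S A : \sum_(e in pairs n) mult S A e <= #|S|%:R * #|A|%:R.
Proof.
rewrite -(eq_bigr _ (fun e _ => mul1r (mult S A e))) (sum_mult (fun=> 1)).
have -> : #|S|%:R * #|A|%:R = \sum_(v in S) \sum_(u in A) 1 :> R.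
  by rewrite !sumr_const mulrC mulr_natr.
by apply: ler_sum => v _; apply: ler_sum => u _; case: ifP.
Qed.

Lemma edge_prob_set2 v u :
  edge_prob p q [set v; u]%SET = rate v.1 u.1.
Proof.
rewrite /edge_prob /rate.
have -> // : [exists i : bool, [set v; u]%SET \subset block n i] = (v.1 == u.1).
apply/existsP/eqP => [[i]|vu].
  by rewrite finset.subUset !finset.sub1set !in_block => /andP[/eqP-> /eqP->].
by exists u.1; rewrite finset.subUset !finset.sub1set !in_block vu eqxx.
Qed.

Lemma mean_degE A i : mean_deg A i = \sum_(u in A) rate i u.1.
Proof.
have card_blk j (c : R) :
    #|A :&: block n j|%:R * c = \sum_(u in A | u.1 == j) c.
  rewrite sumr_const mulrC mulr_natr; congr (_ *+ _); apply: eq_card => u.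
  by rewrite !inE.
rewrite /mean_deg !card_blk [RHS](bigID (fun u => u.1 == i)) /=.
congr (_ + _); first by apply: eq_bigr => u /andP[_ /eqP->]; rewrite /rate eqxx.
rewrite (eq_bigl (fun u => (u \in A) && (u.1 != i))); last first.
  by move=> u; case: (u.1); case: i.
by apply: eq_bigr => u /andP[_ ui]; rewrite /rate eq_sym (negbTE ui).
Qed.

End Counting.

(** * Concentration of edge counts *)

(** This is [expR x <= (1 - x)^-1], from [1 - x <= expR (- x)], and the first
    terms of the geometric series. *)
Lemma expR_le_quad (R : realType) (x : R) :
  x <= 1 / 2 -> expR x <= 1 + x + 2 * x ^+ 2.
Proof.
move=> x_le; have x1 : 0 < 1 - x by lra.
have : expR x * (1 - x) <= 1.
  rewrite -[leRHS](expRxMexpNx_1 x) ler_wpM2l ?expR_ge0//.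
  exact: expR_ge1Dx.
rewrite -ler_pdivlMr // => /le_trans; apply.
rewrite ler_pdivrMr // -subr_ge0.
have -> : (1 + x + 2 * x ^+ 2) * (1 - x) - 1 = x ^+ 2 * (1 - 2 * x) by ring.
by rewrite mulr_ge0 ?sqr_ge0 //; lra.
Qed.

Section Chernoff.
Variables (R : realType) (n : nat) (p q : R).
Hypotheses (q_ge0 : 0 <= q) (le_qp : q <= p) (p_le1 : p <= 1).
Implicit Types (G : graph n) (S A : {set vertex n}).

Local Notation pr := (@sbm_pr R n p q).
Local Notation prob := (@edge_prob R n p q).
Local Notation edges := (@edges R n).
Local Notation mult := (@mult R n).
Local Notation mu := (mean_deg p q).

(** The sign of [l] decides which tail is bounded.  The bound on [l] makes
    every exponent [l * mult S A e] at most [1 / 2], and the factor 8 is twice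
    the bound 4 on [mult]. *)
Lemma edges_upper_tail (l c : R) S A : `|l| <= 1 / 8 ->
  pr (fun G => c <= l * (edges G S A - \sum_(e in pairs n) prob e * mult S A e))
    <= expR (- c + 8 * l ^+ 2 * p * (#|S|%:R * #|A|%:R)).
Proof.
move=> l_le; set EX := \sum_(e in pairs n) _.
pose w := mult S A; have p_ge0 : 0 <= p by apply: le_trans le_qp.
have := @sbm_pr_markov R n p q q_ge0 le_qp p_le1
  (fun G => c <= l * (edges G S A - EX)) (fun e => expR (l * w e)) (expR (c + l * EX)).
move=> /(_ (expR_gt0 _)) /(_ (fun e => expR_ge0 _)) /= markov.
apply: le_trans (markov _) _.
  move=> G GP c_le; rewrite -expR_sum ler_expR -mulr_sumr -edges_mult.
  by move: c_le; rewrite mulrBr lerBrDr.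
rewrite -expRN -expRD ler_expR opprD -addrA lerD2l addrC lerBlDr.
apply: (@le_trans _ _ (\sum_(e in pairs n) (8 * l ^+ 2 * p * w e + l * (prob e * w e)))).
  apply: ler_sum => e eP.
  have Pp := edge_prob_lep le_qp e; have P0 := edge_prob_ge0 q_ge0 le_qp e.
  have w0 : 0 <= w e := mult_ge0 _ _ _ _; have w4 : w e <= 4 := mult_le4 _ _ _ eP.
  have lw : l * w e <= 1 / 2.
    apply: le_trans (ler_norm _) _; rewrite normrM (ger0_norm w0).
    by have := normr_ge0 l; nra.
  have quad : expR (l * w e) - 1 <= l * w e + 2 * (l * w e) ^+ 2.
    by rewrite lerBlDr addrC addrA expR_le_quad.
  apply: le_trans (ler_wpM2l P0 quad) _; rewrite -subr_ge0.
  have -> : 8 * l ^+ 2 * p * w e + l * (prob e * w e)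
      - prob e * (l * w e + 2 * (l * w e) ^+ 2)
    = l ^+ 2 * w e * (2 * (4 * p - prob e * w e)) by ring.
  apply: mulr_ge0; first by rewrite mulr_ge0 ?sqr_ge0.
  rewrite mulr_ge0 // subr_ge0.
  by rewrite (le_trans (ler_wpM2l P0 w4)) // mulrC ler_wpM2l.
rewrite big_split /= -!mulr_sumr lerD2r ler_wpM2l ?sum_mult_le //.
by rewrite mulr_ge0 // mulr_ge0 ?sqr_ge0.
Qed.

(** The difference is the contribution of the loops at the vertices of
    [S :&: A], each of which has weight [p] in [mean_deg]. *)
Lemma sum_mean_deg S A :
  `|\sum_(e in pairs n) prob e * mult S A e - \sum_(v in S) mu A v.1|
    <= p * #|S|%:R.
Proof.
have p_ge0 : 0 <= p by apply: le_trans le_qp.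
rewrite distrC sum_mult -sumrB.
have -> : p * #|S|%:R = \sum_(v in S) p by rewrite sumr_const mulr_natr.
apply: le_trans (ler_norm_sum _ _ _) _; apply: ler_sum => v _.
rewrite mean_degE -sumrB.
have diag u : rate p q v.1 u.1 - (if v != u then prob [set v; u]%SET else 0)
    = if u == v then p else 0.
  rewrite eq_sym; have [->|vu] := eqVneq v u; first by rewrite subr0 /rate eqxx.
  by rewrite edge_prob_set2 subrr.
rewrite (eq_bigr _ (fun u _ => diag u)) -big_mkcondr /=.
have [vA|vA] := boolP (v \in A).
  rewrite (bigD1 v) /= ?vA ?eqxx // big1 ?addr0 ?ger0_norm // => u.
  by case/andP=> /andP[_ ->].
rewrite big1 ?normr0 // => u /andP[uA /eqP uv].
by rewrite uv (negbTE vA) in uA.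
Qed.

Lemma edges_tail (l t : R) S A : 0 <= l <= 1 / 8 ->
  pr (fun G => t + p * #|S|%:R <
      `|edges G S A - \sum_(v in S) mu A v.1|)
    <= 2 * expR (- (l * t) + 8 * l ^+ 2 * p * (#|S|%:R * #|A|%:R)).
Proof.
case/andP=> l_ge0 l_le; have l_norm : `|l| <= 1 / 8 by rewrite ger0_norm.
have up := @edges_upper_tail l (l * t) S A l_norm.
have := @edges_upper_tail (- l) (l * t) S A; rewrite normrN sqrrN => /(_ l_norm) lo.
rewrite mulr_natl mulr2n; apply: le_trans _ (lerD up lo).
apply: le_trans (sbm_pr_or q_ge0 le_qp p_le1 _ _).
apply: sbm_pr_le => // G _; have := sum_mean_deg S A.
set EX := \sum_(e in pairs n) _; set mu := \sum_(v in S) _; move=> EX_mu big.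
have : t <= `|edges G S A - EX|.
  have := ler_distD EX (edges G S A) mu; lra.
have [le0|/ltW ge0] := lerP 0 (edges G S A - EX).
  by rewrite ger0_norm // => tle; left; rewrite ler_wpM2l.
by rewrite ler0_norm // => tle; right; rewrite mulNr -mulrN ler_wpM2l.
Qed.

End Chernoff.

(** * Edges between the two blocks *)

Definition cross_edge (n : nat) (G : graph n) : Prop :=
  exists u v : vertex n, u.1 != v.1 /\ adj G u v.

(** There are [n ^ 2] pairs across the blocks, all of which must be absent. *)
Lemma sbm_pr_cross_edge (R : realType) (n : nat) (p q : R) :
  0 <= q -> q <= p -> p <= 1 ->
  sbm_pr p q (fun G : graph n => ~ cross_edge G) <= expR (- (q * n%:R ^+ 2)).
Proof.
move=> q_ge0 le_qp p_le1.
pose cross (e : {set vertex n}) := ~~ [exists i : bool, e \subset block n i].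
pose a (e : {set vertex n}) : R := (~~ cross e)%:R.
have := @sbm_pr_markov R n p q q_ge0 le_qp p_le1 (fun G => ~ cross_edge G) a 1 ltr01.
move=> /(_ (fun e => ler0n _ _)) markov; apply: le_trans (markov _) _.
  move=> G GP noG; rewrite big1 // => e eG.
  have /cards2P[u [v [uv eE]]] : #|e| == 2 by have := fintype.subsetP GP _ eG; rewrite inE.
  rewrite /a /cross negbK; case: existsP => // nblk; case: noG; exists u, v.
  split; last by rewrite /adj -eE.
  apply/eqP => uv1; apply: nblk; exists u.1.
  by rewrite eE finset.subUset !finset.sub1set !in_block uv1 eqxx.
rewrite invr1 mul1r ler_expR.
pose g (ij : 'I_n * 'I_n) := [set (true, ij.1); (false, ij.2)]%SET : {set vertex n}.
have g_inj : injective g.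
  move=> [i j] [i' j'] /finset.setP eg.
  have := eg (true, i); rewrite !inE eqxx /= orbF => /esym/eqP[->].
  by have := eg (false, j); rewrite !inE eqxx /= => /esym/eqP[->].
have g_cross ij : (g ij \in pairs n) && cross (g ij).
  rewrite inE cards2 /=; apply/existsP => -[i].
  by rewrite finset.subUset !finset.sub1set !in_block /=; case: i.
have -> : - (q * n%:R ^+ 2) = \sum_(e in g @: [set: 'I_n * 'I_n]%SET) - q.
  rewrite sumr_const card_imset // cardsT card_prod card_ord.
  by rewrite -[RHS]mulr_natr natrM; ring.
rewrite [leLHS]big_mkcond [leRHS]big_mkcond; apply: ler_sum => e _.
have [/imsetP[ij _ ->]|_] := boolP (e \in g @: [set: 'I_n * 'I_n]%SET).
  have /andP[-> gc] := g_cross ij; rewrite /a gc /edge_prob.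
  by rewrite (negbTE gc) /=; lra.
case: ifP => // _; have := edge_prob_ge0 q_ge0 le_qp e.
by rewrite /a; case: (cross e) => /=; lra.
Qed.

(** * Quasirandom graphs and their probability *)

Lemma card_block n i : #|block n i| = n.
Proof.
have -> : block n i = [set (i, j) | j in [set: 'I_n]%SET]%SET.
  apply/finset.setP => -[k j]; rewrite in_block /=; apply/eqP/imsetP => [->|].
    by exists j; rewrite ?inE.
  by case=> j' _ [-> _].
by rewrite card_imset ?cardsT ?card_ord // => j j' [].
Qed.

Lemma card_vertex n : #|{: vertex n}| = (2 * n)%N.
Proof. by rewrite card_prod card_bool card_ord. Qed.

Lemma max_card_vertex n (S : {set vertex n}) : (#|S| <= 2 * n)%N.
Proof. by rewrite -card_vertex max_card. Qed.

Lemma mean_deg_block (R : realType) n (p q : R) i j :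
  mean_deg p q (block n j) i = n%:R * rate p q i j.
Proof.
rewrite mean_degE (eq_bigr (fun=> rate p q i j)).
  by rewrite sumr_const card_block mulr_natl.
by move=> u; rewrite in_block => /eqP->.
Qed.

Lemma edges_set1 (R : realType) n (G : graph n) (A : {set vertex n}) u :
  edges R G [set u]%SET A = (deg_in G A u)%:R.
Proof. by rewrite /edges big_set1. Qed.

(** The binomial theorem, graded by the subsets themselves. *)
Lemma sum_expr_card (R : realType) (T : finType) (x : R) :
  \sum_(S : {set T}) x ^+ #|S| = (1 + x) ^+ #|T|.
Proof.
transitivity (\prod_(i : T) (x + 1)); last by rewrite prodr_const addrC.
rewrite bigA_distr; apply: eq_bigr => S _.
by rewrite -big_mkcond prodr_const.
Qed.

Section Quasirandom.
Variables (R : realType) (n : nat) (p q : R).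
Hypotheses (q_ge0 : 0 <= q) (le_qp : q <= p) (p_le1 : p <= 1).
Implicit Types (G : graph n) (S A : {set vertex n}).

Local Notation pr := (@sbm_pr R n p q).
Local Notation mu := (mean_deg p q).
Local Notation L := (ln n%:R : R).
Local Notation D := (n%:R * p).

(** The loops are counted in the reference value, which costs at most
    [p * #|S|] and is absorbed in all the error terms below. *)
Definition discrepancy G S A : R :=
  `|edges R G S A - \sum_(v in S) mu A v.1|.

(** The first bound is sharper for small sets and the second one, free of the
    factor [Num.sqrt L], for sets of linear size. *)
Definition quasirandom (K : R) G : Prop :=
  [/\ forall S A, discrepancy G S A
        <= K * (maxn #|S| #|A|)%:R * Num.sqrt (D * L),
      forall S A, discrepancy G S A <= K * n%:R * Num.sqrt D,
      forall u j, `|(deg_in G (block n j) u)%:R - n%:R * rate p q u.1 j|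
        <= K * Num.sqrt (D * L)
    & cross_edge G].

Hypotheses (L_ge1 : 1 <= L) (le_LD : L <= D).

Let n_gt0 : 0 < n%:R :> R.
Proof.
rewrite ltr0n lt0n; apply: contraTneq L_ge1 => ->.
by rewrite ln0 // -ltNge ltr01.
Qed.

Let D_ge1 : 1 <= D. Proof. exact: le_trans le_LD. Qed.

Let p_ge0 : 0 <= p. Proof. exact: le_trans le_qp. Qed.

Let p_neq0 : p != 0.
Proof.
by apply: contraTneq (lt_le_trans ltr01 D_ge1) => ->; rewrite mulr0 ltxx.
Qed.

Let expRNL : expR (- L) = n%:R^-1.
Proof. by rewrite expRN lnK. Qed.

Let sqrtDL_ge1 : 1 <= Num.sqrt (D * L).
Proof. by rewrite -[leLHS]sqrtr1 ler_wsqrtr // mulr_ege1. Qed.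

Let sqrtD_ge1 : 1 <= Num.sqrt D.
Proof. by rewrite -[leLHS]sqrtr1 ler_wsqrtr. Qed.

Let discrepancy_tail (l t : R) S A : 0 <= l <= 1 / 8 ->
  pr (fun G => t + p * #|S|%:R < discrepancy G S A)
    <= 2 * expR (- (l * t) + 8 * l ^+ 2 * p * (#|S|%:R * #|A|%:R)).
Proof. exact: edges_tail. Qed.

(** The exponential parameter for deviations of order [Num.sqrt (D * L)] per
    vertex: it makes both [l * Num.sqrt (D * L)] and [l ^+ 2 * p * n] of
    order [L]. *)
Let l := Num.sqrt (L / D) / 8.

Let l_itv : 0 <= l <= 1 / 8.
Proof.
rewrite /l divr_ge0 ?sqrtr_ge0 //= ler_pM2r ?invr_gt0 ?ltr0n //.
rewrite -[leRHS]sqrtr1 ler_wsqrtr // ler_pdivrMr ?mul1r //.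
exact: lt_le_trans D_ge1.
Qed.

Let lsqrt : l * Num.sqrt (D * L) = L / 8.
Proof.
have D0 := lt_le_trans ltr01 D_ge1; have L0 := lt_le_trans ltr01 L_ge1.
rewrite /l mulrAC -sqrtrM ?divr_ge0 ?ltW //.
have -> : L / D * (D * L) = L ^+ 2 by field; rewrite p_neq0 lt0r_neq0.
by rewrite sqrtr_sqr ger0_norm // ltW.
Qed.

Let lsqr : 8 * l ^+ 2 * p = L / (8 * n%:R).
Proof.
have D0 := lt_le_trans ltr01 D_ge1; have L0 := lt_le_trans ltr01 L_ge1.
rewrite /l expr_div_n sqr_sqrtr ?divr_ge0 ?ltW //.
by field; rewrite p_neq0 lt0r_neq0.
Qed.

(** A given pair [(S, A)] fails with probability at most
    [2 * n^-(1 + #|S| + #|A|)], and the sum of [n^-#|S|] over all [S] is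
    [(1 + 1/n)^(2n)], hence bounded. *)
Lemma pr_discrepancy_max :
  pr (fun G => exists SA : {set vertex n} * {set vertex n},
    50 * (maxn #|SA.1| #|SA.2|)%:R * Num.sqrt (D * L) < discrepancy G SA.1 SA.2)
  <= 2 * expR 4 / n%:R.
Proof.
pose x : R := n%:R^-1.
apply: le_trans (sbm_pr_exists q_ge0 le_qp p_le1 _) _.
apply: (@le_trans _ _ (\sum_(SA : {set vertex n} * {set vertex n})
    2 * x * (x ^+ #|SA.1| * x ^+ #|SA.2|))); last first.
  rewrite -mulr_sumr.
  rewrite -(pair_big xpredT xpredT (fun S A : {set vertex n} => x ^+ #|S| * x ^+ #|A|)) /=.
  under eq_bigr => S _ do rewrite -mulr_sumr sum_expr_card.
  rewrite -mulr_suml sum_expr_card card_vertex -exprD.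
  rewrite -!mulrA ler_pM2l // mulrC ler_pM2r ?invr_gt0 //.
  have -> : expR 4 = expR x ^+ (2 * n + 2 * n).
    rewrite -expRM_natl natrD !natrM /x; congr expR; field; exact: lt0r_neq0.
  by apply: lerXn2r; rewrite ?nnegrE ?expR_ge0 ?expR_ge1Dx // addr_ge0 ?invr_ge0.
apply: ler_sum => -[S A] _ /=; set b := maxn _ _.
have [b0|b_gt0] := posnP b.
  apply: (@le_trans _ _ 0); last first.
    by rewrite !mulr_ge0 // ?exprn_ge0 // invr_ge0.
  rewrite /sbm_pr big1 // => G /andP[_ /asboolP].
  have /eqP := b0; rewrite -leqn0 geq_max leqn0 cards_eq0 => /andP[/eqP-> _].
  by rewrite /discrepancy /edges !big_set0 subrr normr0 b0 mulr0 mul0r ltxx.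
have b_ge1 : 1 <= b%:R :> R by rewrite ler1n.
have sb : #|S|%:R <= b%:R :> R by rewrite ler_nat leq_maxl.
have ab : #|A|%:R <= b%:R :> R by rewrite ler_nat leq_maxr.
have s2n : #|S|%:R <= 2 * n%:R :> R by rewrite -natrM ler_nat max_card_vertex.
apply: le_trans (le_trans (discrepancy_tail (49 * b%:R * Num.sqrt (D * L)) S A l_itv) _).
  apply: sbm_pr_le => // G _; apply: le_lt_trans.
  have := sqrtDL_ge1; have : 0 <= #|S|%:R :> R by [].
  have := p_le1; have := p_ge0; nra.
rewrite -[leRHS]mulrA ler_pM2l // -exprD -exprS /x -expRNL -expRM_natl ler_expR.
rewrite mulrCA lsqrt lsqr mulrN.
have : L / (8 * n%:R) * (#|S|%:R * #|A|%:R) <= b%:R * L / 4.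
  have -> : b%:R * L / 4 = L / (8 * n%:R) * ((2 * n%:R) * b%:R).
    by field; exact: lt0r_neq0.
  have L_ge0 : 0 <= L by apply: le_trans L_ge1.
  by apply: ler_wpM2l; [rewrite divr_ge0 // mulr_ge0 | apply: ler_pM].
have : (#|S| + #|A|).+1%:R * L <= 3 * b%:R * L.
  rewrite ler_wpM2r //; first exact: le_trans L_ge1.
  by rewrite -addn1 !natrD; lra.
by have := L_ge1; nra.
Qed.

(** A given pair fails with probability at most [2 * expR (- 5 n)], and there
    are [2 ^ (4 n) <= expR (4 n)] pairs. *)
Lemma pr_discrepancy_all :
  pr (fun G => exists SA : {set vertex n} * {set vertex n},
    50 * n%:R * Num.sqrt D < discrepancy G SA.1 SA.2) <= 2 / n%:R.
Proof.
have D0 := lt_le_trans ltr01 D_ge1; have s0 := lt_le_trans ltr01 sqrtD_ge1.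
apply: le_trans (sbm_pr_exists q_ge0 le_qp p_le1 _) _.
apply: (@le_trans _ _ (\sum_(SA : {set vertex n} * {set vertex n})
    2 * expR (- (5 * n%:R)))); last first.
  have cardS : #|{: {set vertex n}}| = (2 ^ (2 * n))%N.
    rewrite -card_vertex -[in RHS]cardsT -card_powerset -cardsT.
    by apply: eq_card => S; rewrite !inE finset.subsetT.
  rewrite sumr_const card_prod !cardS -[leLHS]mulr_natr -[leLHS]mulrA ler_pM2l //.
  have : (2 ^ (2 * n) * 2 ^ (2 * n))%:R <= expR (4 * n%:R) :> R.
    rewrite -expnD addnn -mul2n mulnA natrX -natrM -[(4 * n)%:R]mulr1 expRM_natl.
    rewrite lerXn2r ?nnegrE ?expR_ge0 //.
    by rewrite (_ : 2 = 1 + 1) ?expR_ge1Dx.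
  move=> /(ler_wpM2l (expR_ge0 (- (5 * n%:R)))) /le_trans; apply.
  rewrite -expRD (_ : _ + _ = - n%:R); last by ring.
  rewrite expRN lef_pV2 ?posrE ?expR_gt0 //.
  by apply: le_trans (expR_ge1Dx _); rewrite lerDr.
apply: ler_sum => -[S A] _ /=.
have s2n : #|S|%:R <= 2 * n%:R :> R by rewrite -natrM ler_nat max_card_vertex.
have a2n : #|A|%:R <= 2 * n%:R :> R by rewrite -natrM ler_nat max_card_vertex.
have k_itv : 0 <= (Num.sqrt D)^-1 / 8 <= 1 / 8.
  rewrite divr_ge0 ?invr_ge0 ?sqrtr_ge0 //= ler_pM2r ?invr_gt0 ?ltr0n //.
  by rewrite invf_le1.
apply: le_trans (le_trans (discrepancy_tail (48 * n%:R * Num.sqrt D) S A k_itv) _).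
  apply: sbm_pr_le => // G _; apply: le_lt_trans.
  by have := p_le1; have := p_ge0; have := sqrtD_ge1; have := n_gt0; nra.
rewrite ler_pM2l // ler_expR.
rewrite (_ : _ * (48 * n%:R * Num.sqrt D) = 6 * n%:R); last first.
  by field; apply: lt0r_neq0.
rewrite expr_div_n exprVn (sqr_sqrtr (ltW D0)).
have -> : 8 * (D^-1 / 8 ^+ 2) * p = (8 * n%:R)^-1.
  by field; rewrite p_neq0 lt0r_neq0.
have -> : - (5 * n%:R) = - (6 * n%:R) + (8 * n%:R)^-1 * (8 * n%:R * n%:R) :> R.
  by field; apply: lt0r_neq0.
rewrite lerD2l; apply: ler_wpM2l; first by rewrite invr_ge0 mulr_ge0.
apply: le_trans (ler_pM _ _ s2n a2n) _ => //.
by have := n_gt0; nra.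
Qed.

(** The instance [S = [set u]], [A = block n j] of the tail bound, for which
    the exponent is of order [L]. *)
Lemma pr_deg :
  pr (fun G => exists uj : vertex n * bool,
    50 * Num.sqrt (D * L) <
      `|(deg_in G (block n uj.2) uj.1)%:R - n%:R * rate p q uj.1.1 uj.2|)
  <= 8 / n%:R.
Proof.
apply: le_trans (sbm_pr_exists q_ge0 le_qp p_le1 _) _.
apply: (@le_trans _ _ (\sum_(uj : vertex n * bool) 2 * n%:R^-1 ^+ 2)); last first.
  rewrite sumr_const card_prod card_vertex card_bool -[leLHS]mulr_natr !natrM.
  rewrite le_eqVlt; apply/orP; left; apply/eqP.
  by field; exact: lt0r_neq0.
apply: ler_sum => -[u j] _ /=.
apply: le_trans (le_trans
  (discrepancy_tail (49 * Num.sqrt (D * L)) [set u]%SET (block n j) l_itv) _).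
  apply: sbm_pr_le => // G _; rewrite /discrepancy edges_set1 big_set1 mean_deg_block.
  apply: le_lt_trans; rewrite cards1 mulr1.
  by have := p_le1; have := sqrtDL_ge1; lra.
rewrite ler_pM2l // -expRNL -expRM_natl ler_expR.
rewrite mulrCA lsqrt lsqr cards1 card_block mul1r.
rewrite (_ : _ / _ * n%:R = L / 8); last by field; exact: lt0r_neq0.
by have := L_ge1; lra.
Qed.

Lemma pr_quasirandom : L / n%:R ^+ 2 <= q ->
  1 - (2 * expR 4 + 11) / n%:R <= pr (quasirandom 50).
Proof.
move=> q_ge; rewrite sbm_pr_not lerD2l lerN2.
have cross : pr (fun G => ~ cross_edge G) <= n%:R^-1.
  apply: le_trans (@sbm_pr_cross_edge R n p q q_ge0 le_qp p_le1) _.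
  rewrite -expRNL ler_expR lerN2 -ler_pdivrMr //.
  by rewrite exprn_gt0.
have -> : (2 * expR 4 + 11) / n%:R
    = 2 * expR 4 / n%:R + (2 / n%:R + (8 / n%:R + n%:R^-1)) :> R by lra.
have pr_or := @sbm_pr_or R n p q q_ge0 le_qp p_le1.
apply: le_trans (le_trans (pr_or _ _) (lerD pr_discrepancy_max
  (le_trans (pr_or _ _) (lerD pr_discrepancy_all
  (le_trans (pr_or _ _) (lerD pr_deg cross)))))).
apply: sbm_pr_le => // G _ notQ; apply: contrapT => not_bad; apply: notQ.
split=> [S A|S A|u j|]; last by apply: contrapT => nc; apply: not_bad; do 3 right.
- by rewrite leNgt; apply/negP => bad; apply: not_bad; left; exists (S, A).
- by rewrite leNgt; apply/negP => bad; apply: not_bad; right; left; exists (S, A).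
by rewrite leNgt; apply/negP => bad; apply: not_bad; do 2 right; left; exists (u, j).
Qed.

End Quasirandom.

(** * Second-order expansion of polynomials *)

(** The remainder of [g * 'X + c] involves the value and the derivative of
    [g], so the induction on [f] has to bound these as well. *)
Lemma poly_taylor2_itv (R : realType) (f : {poly R}) :
  exists2 F : R, 0 < F & forall x m : R, 0 <= x <= 1 -> 0 <= m <= 1 ->
    [/\ `|f.[m]| <= F, `|f^`().[m]| <= F &
        `|f.[x] - f.[m] - f^`().[m] * (x - m)| <= F * (x - m) ^+ 2].
Proof.
elim/poly_ind: f => [|g c [F F_gt0 IH]].
  exists 1 => // x m _ _; rewrite deriv0 !horner0 mul0r !subr0 normr0 mul1r.
  by rewrite sqr_ge0 ler01.
exists (3 * F + `|c|) => [|x m x01 m01]; first by have := normr_ge0 c; lra.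
have [gm g'm taylor] := IH x m x01 m01.
have /andP[m0 m1] := m01.
have m_norm : `|m| <= 1 by rewrite ger0_norm.
have c_ge0 := normr_ge0 c.
have shrink y : `|y| <= F -> `|y * m| <= F.
  by rewrite normrM => yF; have := normr_ge0 y; have := normr_ge0 m; nra.
rewrite derivMXaddC !hornerMXaddC hornerD hornerM hornerX; split.
- by rewrite (le_trans (ler_normD _ _)) // lerD2r (le_trans (shrink _ gm)) //; lra.
- by rewrite (le_trans (ler_normD _ _)) //; have := shrink _ g'm; lra.
have sqE : (x - m) ^+ 2 = `|x - m| ^+ 2 by rewrite real_normK ?num_real.
have lip : `|g.[x] - g.[m]| <= 2 * F * `|x - m|.
  rewrite -(subrK (g^`().[m] * (x - m)) (g.[x] - g.[m])).
  apply: le_trans (ler_normD _ _) _; rewrite normrM.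
  have xm1 : `|x - m| <= 1 by rewrite ler_norml; lra.
  apply: le_trans (lerD taylor (ler_wpM2r (normr_ge0 _) g'm)) _.
  have sq_le : `|x - m| ^+ 2 <= `|x - m| by rewrite expr2 ler_piMl.
  by rewrite sqE; have := ler_wpM2l (ltW F_gt0) sq_le; lra.
rewrite (_ : _ - _ - _ = m * (g.[x] - g.[m] - g^`().[m] * (x - m))
                        + (x - m) * (g.[x] - g.[m])); last by ring.
apply: le_trans (ler_normD _ _) _; rewrite !normrM.
have := ler_pM (normr_ge0 _) (normr_ge0 _) m_norm taylor.
have := ler_wpM2l (normr_ge0 (x - m)) lip.
rewrite sqE.
have := mulr_ge0 c_ge0 (sqr_ge0 `|x - m|).
by nra.
Qed.

(** * Quasirandom graphs are good *)

Section Deterministic.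
Variables (R : realType) (n : nat) (p q K : R) (G : graph n).
Local Notation L := (ln n%:R : R).
Local Notation D := (n%:R * p).
Local Notation r := (Num.sqrt (D * L)).
Local Notation mu := (mean_deg p q).
Hypotheses (n_gt0 : 0 < n%:R :> R) (p_gt0 : 0 < p) (q_ge0 : 0 <= q).
(* The factor 8 leaves all degrees at least [3 / 4] of their reference value,
   and all edge counts in (P1) away from 0. *)
Hypotheses (K_gt0 : 0 < K) (r_gt0 : 0 < r) (large : 8 * K * r <= D).
Hypothesis quasi : quasirandom p q K G.
Implicit Types (S A : {set vertex n}) (u v : vertex n).

Let disc_max S A :
  discrepancy p q G S A <= K * (maxn #|S| #|A|)%:R * r.
Proof. by case: quasi => + _ _ _; exact. Qed.

Let disc_all S A : discrepancy p q G S A <= K * n%:R * Num.sqrt D.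
Proof. by case: quasi => _ + _ _; exact. Qed.

Let deg_block u j : `|(deg_in G (block n j) u)%:R - n%:R * rate p q u.1 j| <= K * r.
Proof. by case: quasi => _ _ + _; exact. Qed.

Lemma deg_in_sub (A B : {set vertex n}) v : A \subset B -> (deg_in G A v <= deg_in G B v)%N.
Proof.
move=> AB; apply: subset_leq_card; apply/fintype.subsetP => u; rewrite !inE.
by case/andP=> /(fintype.subsetP AB)-> ->.
Qed.

Lemma sum_mean_deg_block i (U : {set vertex n}) : U \subset block n i ->
  \sum_(v in U) mu U v.1 = #|U|%:R * (#|U|%:R * p).
Proof.
move=> Ui; rewrite mulr_natl -[RHS]sumr_const; apply: eq_bigr => v vU.
have blkU w : w \in U -> w.1 = i.
  by move=> wU; apply/eqP; rewrite -in_block (fintype.subsetP Ui).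
rewrite mean_degE mulr_natl -[RHS]sumr_const; apply: eq_bigr => u uU.
by rewrite /rate !blkU // eqxx.
Qed.

(** The degrees into the block of the vertices of [U] add up to about
    [D * #|U|].  Without an exit they would all come from edges inside [U], but
    these contribute only about [#|U| ^ 2 * p <= D * #|U| / 2]. *)
Lemma exit_block i (U : {set vertex n}) :
    U \subset block n i -> U != finset.set0 -> (2 * #|U| <= n)%N ->
  exists v w, [/\ v \in U, w \in block n i :\: U & adj G v w].
Proof.
move=> Ui U0 Un; apply: contrapT => noexit.
have degU v : v \in U -> deg_in G (block n i) v = deg_in G U v.
  move=> vU; apply/eqP; rewrite eqn_leq (deg_in_sub _ Ui) andbT.
  apply: subset_leq_card; apply/fintype.subsetP => w; rewrite !inE => /andP[wi vw].
  rewrite vw andbT; apply: contrapT => /negP wU; apply: noexit; exists v, w.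
  by rewrite !inE wU wi.
have U_gt0 : 0 < #|U|%:R :> R by rewrite ltr0n card_gt0.
have lower : #|U|%:R * (D - K * r) <= edges R G U U.
  rewrite mulr_natl -sumr_const; apply: ler_sum => v vU; rewrite -degU //.
  have vi : v.1 = i by apply/eqP; rewrite -in_block (fintype.subsetP Ui).
  by have := deg_block v i; rewrite /rate vi eqxx ler_norml; lra.
have means := sum_mean_deg_block Ui.
have := disc_max U U; rewrite /discrepancy means maxnn ler_norml => /andP[_ upper].
have half : 2 * #|U|%:R <= n%:R :> R by rewrite -natrM ler_nat.
have : D - K * r <= #|U|%:R * p + K * r.
  by rewrite -(ler_pM2l U_gt0); lra.
have : 2 * (#|U|%:R * p) <= D by rewrite mulrA ler_wpM2r // ltW.
by have := mulr_gt0 K_gt0 r_gt0; have := large; lra.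
Qed.

(** The component of [u] in its block, or the rest of the block, is a set to
    which [exit_block] applies. *)
Lemma connect_block u v : u.1 = v.1 -> connect (adj G) u v.
Proof.
move=> uv; pose i := v.1.
have sym : connect_sym (adj G).
  by apply: sym_connect_sym => x y; rewrite adjC.
pose S := [set w in block n i | connect (adj G) u w]%SET.
pose T := block n i :\: S.
apply: contrapT => /negP nuv.
have uS : u \in S by rewrite !inE uv eqxx connect0.
have vT : v \in T by rewrite !inE eqxx /= andbT.
have ST : (#|S| + #|T| = n)%N.
  transitivity #|block n i|; last exact: card_block.
  rewrite -(cardsID S (block n i)); congr (_ + _)%N.
  by apply: eq_card => w; rewrite !inE andbA andbb.
have closed x y : x \in S -> y \in T -> ~ adj G x y.
  rewrite !inE => /andP[_ ux] /andP[+ yi] xy; rewrite yi /= => /negP; apply.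
  by apply: connect_trans ux (connect1 xy).
have [le_ST|lt_TS] := leqP #|S| #|T|.
  have [|||x [y [xS yT xy]]] := @exit_block i S.
  - by apply/fintype.subsetP => w; rewrite !inE => /andP[].
  - by apply/set0Pn; exists u.
  - by rewrite mul2n -addnn -[leqRHS]ST leq_add2l.
  by case: (closed x y).
have [|||x [y [xT yS xy]]] := @exit_block i T.
- exact: finset.subsetDl.
- by apply/set0Pn; exists v.
- by rewrite mul2n -addnn -[leqRHS]ST leq_add2r ltnW.
apply: (closed y x) => //; last by rewrite adjC.
by move: yS; rewrite !inE; case: (y.1 == i); case: (connect _ _ _).
Qed.

Lemma quasirandom_connected : connected_graph G.
Proof.
have [a [b [ab_blk ab]]] : cross_edge G by case: quasi.
move=> u v; have [uv|uv] := eqVneq u.1 v.1; first exact: connect_block.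
wlog ua : a b ab_blk ab / u.1 = a.1.
  move=> wl; have [ua|ua] := eqVneq u.1 a.1; first exact: (wl a b).
  apply: (wl b a); rewrite 1?eq_sym 1?adjC //.
  by move: ua ab_blk; case: (u.1) (a.1) (b.1) => [] [] [].
have bv : b.1 = v.1.
  by move: uv ab_blk; rewrite ua; case: (v.1) (a.1) (b.1) => [] [] [].
apply: connect_trans (connect_block ua) _.
exact: connect_trans (connect1 ab) (connect_block bv).
Qed.

(** One colour class contains half of a block, and a set of this size spans
    about [#|U| ^ 2 * p] edges, too many to be compensated by the deviation. *)
Lemma quasirandom_not_bipartite : ~ bipartite G.
Proof.
case=> X bip.
have [U [Ub Un Uindep]] : exists U : {set vertex n},
    [/\ U \subset block n true, (n <= 2 * #|U|)%N & 
        forall u v, u \in U -> v \in U -> ~~ adj G u v].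
  have indep (Y : {set vertex n}) : Y = X \/ Y = ~: X ->
      forall u v, u \in block n true :&: Y -> v \in block n true :&: Y -> ~~ adj G u v.
    move=> YX u v /setIP[_ uY] /setIP[_ vY]; apply/negP => /bip.
    by case: YX uY vY => ->; rewrite ?inE => + +; case: (u \in X) (v \in X) => [] [].
  have cards := cardsID X (block n true); rewrite card_block in cards.
  have [le|lt] := leqP #|block n true :\: X| #|block n true :&: X|.
    exists (block n true :&: X); split; first exact: finset.subsetIl.
      by rewrite -[leqLHS]cards mul2n -addnn leq_add2l.
    by apply: indep; left.
  exists (block n true :&: ~: X); split; first exact: finset.subsetIl.
    by rewrite -finset.setDE -[leqLHS]cards mul2n -addnn leq_add2r ltnW.
  by apply: indep; right.
have no_edges : edges R G U U = 0.
  rewrite /edges big1 // => v vU; rewrite deg_inE big1 // => u uU.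
  by rewrite (negbTE (Uindep v u vU uU)).
have means := sum_mean_deg_block Ub.
have half : n%:R <= 2 * #|U|%:R :> R by rewrite -natrM ler_nat.
have U_gt0 : 0 < #|U|%:R :> R by have := n_gt0; lra.
have := disc_max U U; rewrite /discrepancy means maxnn no_edges sub0r normrN.
rewrite ger0_norm ?mulr_ge0 ?(ltW p_gt0) // => upper.
have : #|U|%:R * p <= K * r by rewrite -(ler_pM2l U_gt0); lra.
have : D <= 2 * (#|U|%:R * p) by rewrite mulrA ler_wpM2r // ltW.
by have := mulr_gt0 K_gt0 r_gt0; have := large; lra.
Qed.


Definition dev A v : R := (deg_in G A v)%:R - mu A v.1.

Definition frac A v : R := (deg_in G A v)%:R / (deg G v)%:R.

Definition mean_frac A i : R := mu A i / (n%:R * (p + q)).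

Local Notation d := (n%:R * (p + q)).

Let D_gt0 : 0 < D. Proof. exact: mulr_gt0. Qed.

Let le_Dd : D <= d. Proof. by rewrite ler_pM2l // lerDl. Qed.

Let d_gt0 : 0 < d. Proof. exact: lt_le_trans le_Dd. Qed.

Lemma discrepancyE S A : discrepancy p q G S A = `|\sum_(v in S) dev A v|.
Proof. by rewrite /discrepancy /edges -sumrB. Qed.

(** The vertices with positive and with negative deviation are two sets to
    which a bound that is uniform over sets applies. *)
Lemma sum_dev_le A (T : {set vertex n}) c :
    (forall T' : {set vertex n}, T' \subset T -> discrepancy p q G T' A <= c) ->
  \sum_(v in T) `|dev A v| <= 2 * c.
Proof.
move=> Tc; rewrite (bigID (fun v => 0 <= dev A v)) /= mulr_natl mulr2n.
pose T1 := [set v in T | 0 <= dev A v]%SET; pose T2 := T :\: T1.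
apply: lerD.
  have -> : \sum_(v in T | 0 <= dev A v) `|dev A v| = \sum_(v in T1) dev A v.
    apply: eq_big => v; first by rewrite inE.
    by case/andP=> _; exact: ger0_norm.
  apply: le_trans (ler_norm _) _; rewrite -discrepancyE; apply: Tc.
  by apply/fintype.subsetP => v; rewrite inE => /andP[].
have -> : \sum_(v in T | ~~ (0 <= dev A v)) `|dev A v| = - \sum_(v in T2) dev A v.
  rewrite -sumrN; apply: eq_big => v; first by rewrite !inE; case: (v \in T); rewrite ?andbT ?andbF.
  by rewrite -ltNge => /andP[_ /ltW]; exact: ler0_norm.
apply: le_trans (ler_norm _) _; rewrite normrN -discrepancyE; apply: Tc.
exact: finset.subsetDl.
Qed.

Lemma mean_degT i : mu [set: vertex n]%SET i = d.
Proof. by rewrite /mean_deg !finset.setTI !card_block mulrDr. Qed.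

Lemma mean_deg_itv A i : 0 <= mu A i <= d.
Proof.
rewrite /mean_deg addr_ge0 ?mulr_ge0 ?(ltW p_gt0) //= mulrDr.
have cap j : #|A :&: block n j|%:R <= n%:R :> R.
  by rewrite ler_nat -[leqRHS](card_block n j) subset_leq_card ?finset.subsetIr.
by apply: lerD; rewrite ler_wpM2r // ltW.
Qed.

Lemma frac_itv A v : 0 <= frac A v <= 1.
Proof.
rewrite /frac divr_ge0 //=.
have [->|deg_gt0] := posnP (deg G v); first by rewrite invr0 mulr0 ler01.
rewrite ler_pdivrMr ?ltr0n // mul1r ler_nat.
exact: deg_in_sub (finset.subsetT A).
Qed.

Lemma mean_frac_itv A i : 0 <= mean_frac A i <= 1.
Proof.
have /andP[m0 md] := mean_deg_itv A i; rewrite /mean_frac divr_ge0 ?(ltW d_gt0) //=.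
by rewrite ler_pdivrMr // mul1r.
Qed.

(** Writing the numerator as [frac A v] times the degree avoids any lower bound
    on the degree, and includes isolated vertices. *)
Lemma frac_devE A v : frac A v - mean_frac A v.1
  = (dev A v - frac A v * dev [set: vertex n]%SET v) / d.
Proof.
have fracM : frac A v * (deg G v)%:R = (deg_in G A v)%:R.
  have [deg0|deg_gt0] := posnP (deg G v); last by rewrite divfK // pnatr_eq0 -lt0n.
  have := deg_in_sub v (finset.subsetT A); rewrite -/(deg G v) deg0 leqn0 => /eqP->.
  by rewrite mulr0.
rewrite /dev mean_degT mulrBr fracM /mean_frac.
by move: (lt0r_neq0 d_gt0); set e := d => e_neq0; field.
Qed.

Lemma norm_frac_dev A v : `|frac A v - mean_frac A v.1|
  <= (`|dev A v| + `|dev [set: vertex n]%SET v|) / D.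
Proof.
have /andP[x0 x1] := frac_itv A v.
have d_inv : 0 <= d^-1 by rewrite invr_ge0 ltW.
rewrite frac_devE normrM (ger0_norm d_inv).
apply: ler_pM => //.
  apply: le_trans (ler_normB _ _) _; rewrite lerD2l normrM ger0_norm //.
  by rewrite ler_piMl.
by rewrite lef_pV2 ?posrE.
Qed.

Lemma deg_split v : deg G v = (deg_in G (block n true) v + deg_in G (block n false) v)%N.
Proof.
apply/eqP; rewrite -(eqr_nat R) natrD /deg !deg_inE.
rewrite (bigID (fun u => u \in block n true)) /=; apply/eqP; congr (_ + _).
  by apply: eq_bigl => u; rewrite finset.in_setT.
by apply: eq_bigl => u; rewrite !inE; case: (u.1).
Qed.

Lemma dev_deg_le v : `|dev [set: vertex n]%SET v| <= 2 * (K * r).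
Proof.
rewrite /dev mean_degT -/(deg G v) deg_split natrD.
have -> : d = n%:R * rate p q v.1 true + n%:R * rate p q v.1 false.
  by rewrite /rate; case: (v.1) => /=; ring.
rewrite opprD addrACA [leRHS]mulr_natl mulr2n.
by apply: le_trans (ler_normD _ _) _; apply: lerD; exact: deg_block.
Qed.

Lemma sum_frac_dev_all A :
  \sum_v `|frac A v - mean_frac A v.1| <= 4 * K * Num.sqrt (n%:R / p).
Proof.
apply: le_trans (ler_sum _ (fun v _ => norm_frac_dev A v)) _.
rewrite -mulr_suml big_split /= ler_pdivrMr //.
have dev_all B : \sum_v `|dev B v| <= 2 * (K * n%:R * Num.sqrt D).
  have -> : \sum_v `|dev B v| = \sum_(v in [set: vertex n]%SET) `|dev B v|.
    by apply: eq_bigl => v; rewrite finset.in_setT.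
  by apply: sum_dev_le => T' _; exact: disc_all.
apply: le_trans (lerD (dev_all A) (dev_all _)) _.
have -> : Num.sqrt (n%:R / p) = n%:R / Num.sqrt D.
  have -> : n%:R / p = n%:R ^+ 2 / D by field; rewrite !lt0r_neq0.
  by rewrite sqrtrM ?sqr_ge0 // sqrtr_sqr sqrtrV ?ger0_norm ?(ltW D_gt0).
have s0 : 0 < Num.sqrt D by rewrite sqrtr_gt0.
rewrite -[X in _ <= _ * X](sqr_sqrtr (ltW D_gt0)) le_eqVlt; apply/orP; left; apply/eqP.
by field; exact: lt0r_neq0.
Qed.

Local Notation theta := (4 * K * r / D).

Let theta_gt0 : 0 < theta. Proof. by rewrite divr_gt0 // !mulr_gt0. Qed.

Lemma sum_frac_dev_set S A :
  \sum_(v in S) `|frac A v - mean_frac A v.1| <= theta * (maxn #|S| #|A|)%:R.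
Proof.
apply: le_trans (ler_sum _ (fun v _ => norm_frac_dev A v)) _.
rewrite -mulr_suml mulrAC ler_pM2r ?invr_gt0 // big_split /=.
set b := maxn _ _.
have devA : \sum_(v in S) `|dev A v| <= 2 * (K * b%:R * r).
  apply: sum_dev_le => T' T'S; apply: le_trans (disc_max _ _) _.
  rewrite ler_pM2r // ler_pM2l // ler_nat geq_max leq_maxr andbT.
  exact: leq_trans (subset_leq_card T'S) (leq_maxl _ _).
have devT : \sum_(v in S) `|dev [set: vertex n]%SET v| <= b%:R * (2 * (K * r)).
  apply: le_trans (ler_sum _ (fun v _ => dev_deg_le v)) _.
  rewrite sumr_const -[leLHS]mulr_natl ler_wpM2r ?ler_nat ?leq_maxl //.
  by rewrite !mulr_ge0 // ltW.
by apply: le_trans (lerD devA devT) _; rewrite le_eqVlt; apply/orP; left; apply/eqP; ring.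
Qed.

Lemma sum_frac_le A : \sum_v frac A v <= 3 * #|A|%:R.
Proof.
have deg_lo v : 3 / 4 * d <= (deg G v)%:R.
  have := dev_deg_le v; rewrite /dev mean_degT -/(deg G v) ler_norml => /andP[lo _].
  by have := large; have := le_Dd; lra.
have deg_up v : (deg G v)%:R <= 5 / 4 * d.
  have := dev_deg_le v; rewrite /dev mean_degT -/(deg G v) ler_norml => /andP[_ up].
  by have := large; have := le_Dd; lra.
have frac_le v : frac A v <= (deg_in G A v)%:R / (3 / 4 * d).
  have c_gt0 : 0 < 3 / 4 * d by rewrite mulr_gt0 // divr_gt0.
  rewrite /frac ler_wpM2l // lef_pV2 ?posrE //.
  exact: lt_le_trans (deg_lo v).
apply: le_trans (ler_sum _ (fun v _ => frac_le v)) _.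
rewrite -mulr_suml ler_pdivrMr; last by rewrite mulr_gt0 // divr_gt0.
have -> : \sum_v (deg_in G A v)%:R = edges R G A [set: vertex n]%SET.
  rewrite edgesC; apply: eq_bigl => v; by rewrite finset.in_setT.
apply: (@le_trans _ _ (\sum_(v in A) 5 / 4 * d)); first by apply: ler_sum => v _; exact: deg_up.
rewrite sumr_const -[leLHS]mulr_natl.
have A0 : 0 <= #|A|%:R :> R by [].
by have := mulr_ge0 A0 (ltW d_gt0); lra.
Qed.

Lemma sum_mean_frac A : \sum_(v : vertex n) mean_frac A v.1 = #|A|%:R.
Proof.
have -> : \sum_(v : vertex n) mean_frac A v.1 = \sum_i \sum_(j < n) mean_frac A i.
  by rewrite pair_big.
rewrite big_bool !sumr_const card_ord /mean_frac /mean_deg /=.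
have -> : #|A|%:R = #|A :&: block n true|%:R + #|A :&: block n false|%:R :> R.
  rewrite -natrD -(cardsID (block n true) A); congr (_ + _)%:R.
  by apply: eq_card => u; rewrite !inE; case: (u.1); rewrite ?andbT ?andbF.
have pq_neq0 : p + q != 0 by rewrite lt0r_neq0 // ltr_wpDr.
rewrite -mulrnDl -[LHS]mulr_natl; field.
by rewrite pq_neq0 lt0r_neq0.
Qed.

(** Let [z] be the deviation and [S] the set where it exceeds [theta].  If [S]
    were nonempty with at least [#|A|] elements, [sum_frac_dev_set] would bound its sum by
    [theta * #|S|], contradicting the definition of [S].  Hence the sum over
    [S] is at most [theta * #|A|], and there [z ^+ 2 <= z]; elsewhere
    [z ^+ 2 <= theta * z], and the sum of [z] is [O(#|A|)]. *)
Lemma sum_frac_dev_sqr A :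
  \sum_v (frac A v - mean_frac A v.1) ^+ 2 <= 5 * theta * #|A|%:R.
Proof.
pose z v := `|frac A v - mean_frac A v.1|.
have z_ge0 v : 0 <= z v by exact: normr_ge0.
have z_le1 v : z v <= 1.
  rewrite /z ler_norml; have := frac_itv A v; have := mean_frac_itv A v.1; lra.
have sumz : \sum_v z v <= 4 * #|A|%:R.
  have -> : 4 * #|A|%:R = 3 * #|A|%:R + #|A|%:R :> R by ring.
  rewrite -[X in _ <= _ + X]sum_mean_frac.
  apply: le_trans _ (lerD (sum_frac_le A) (lexx _)); rewrite -big_split /=.
  apply: ler_sum => v _; apply: le_trans (ler_normB _ _) _.
  have /andP[x0 _] := frac_itv A v; have /andP[m0 _] := mean_frac_itv A v.1.
  by rewrite !ger0_norm.
pose S := [set v | theta < z v]%SET.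
have sumS : \sum_(v in S) z v <= theta * #|A|%:R.
  have sS := sum_frac_dev_set S A.
  have [ltSA|leAS] := ltnP #|S| #|A|.
    by move: sS; rewrite (maxn_idPr (ltnW ltSA)).
  have S0 : S = finset.set0.
    apply/eqP; apply: contraT => /set0Pn[v vS].
    suff : \sum_(w in S) theta < \sum_(w in S) z w.
      rewrite sumr_const -[ltLHS]mulr_natr => /lt_le_trans/(_ sS).
      by rewrite (maxn_idPl leAS) ltxx.
    apply: ltr_sum => [|w]; last by rewrite inE.
    by apply/hasP; exists v; rewrite ?mem_index_enum.
  by rewrite S0 big_set0 mulr_ge0 // ltW.
apply: (@le_trans _ _ (\sum_v (theta * z v + (if v \in S then z v else 0)))).
  apply: ler_sum => v _; rewrite -(real_normK (num_real _)) -/(z v) expr2.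
  rewrite inE; case: ltP => [lt|le].
    rewrite -[leLHS]add0r; apply: lerD; first by rewrite mulr_ge0 // ltW.
    by rewrite ler_piMl.
  by rewrite addr0 ler_wpM2r.
rewrite big_split -mulr_sumr -big_mkcond /=.
have -> : 5 * theta * #|A|%:R = theta * (4 * #|A|%:R) + theta * #|A|%:R by ring.
by apply: lerD; rewrite // ler_wpM2l // ltW.
Qed.

(** The deviations of [deg_in G A v] have to cancel here: their sum over the
    block equals the sum over [A] of the deviations of the degrees into the
    block, and each of these is [O(r)]. *)
Lemma sum_frac_dev_block A i :
  `|\sum_(v in block n i) (frac A v - mean_frac A v.1)| <= 2 * theta * #|A|%:R.
Proof.
rewrite (eq_bigr _ (fun v _ => frac_devE A v)) -mulr_suml sumrB normrM.
have d_inv : 0 <= d^-1 by rewrite invr_ge0 ltW.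
rewrite (ger0_norm d_inv).
have devA : `|\sum_(v in block n i) dev A v| <= #|A|%:R * (K * r).
  rewrite /dev sumrB -/(edges R G (block n i) A) edgesC /edges.
  have -> : \sum_(v in block n i) mu A v.1
      = \sum_(u in A) n%:R * rate p q u.1 i.
    rewrite (eq_bigr (fun=> mu A i)) => [|v]; last by rewrite in_block => /eqP->.
    rewrite sumr_const card_block -[LHS]mulr_natl mean_degE mulr_sumr.
    by apply: eq_bigr => u _; rewrite /rate eq_sym.
  rewrite -sumrB mulr_natl -sumr_const; apply: le_trans (ler_norm_sum _ _ _) _.
  by apply: ler_sum => u _; exact: deg_block.
have devT : `|\sum_(v in block n i) frac A v * dev [set: vertex n]%SET v|
    <= 3 * #|A|%:R * (2 * (K * r)).
  apply: le_trans (ler_norm_sum _ _ _) _.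
  apply: (@le_trans _ _ (\sum_v frac A v * (2 * (K * r)))); last first.
    rewrite -mulr_suml ler_wpM2r ?sum_frac_le //.
    by rewrite !mulr_ge0 // ltW.
  rewrite big_mkcond; apply: ler_sum => v _; have /andP[x0 _] := frac_itv A v.
  case: ifP => _; last by rewrite !mulr_ge0 // ltW.
  by rewrite normrM ger0_norm // ler_wpM2l // dev_deg_le.
have D1 : d^-1 <= D^-1 by rewrite lef_pV2 ?posrE.
apply: le_trans (ler_pM _ _ (le_trans (ler_normB _ _) (lerD devA devT)) D1) _ => //.
have -> : 2 * theta * #|A|%:R = (8 * (#|A|%:R * (K * r))) / D by ring.
rewrite ler_pM2r ?invr_gt0 //.
have A0 : 0 <= #|A|%:R :> R by [].
by have := mulr_ge0 A0 (ltW (mulr_gt0 K_gt0 r_gt0)); lra.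
Qed.


Variables (f : {poly R}) (F : R).
Hypothesis taylor : forall x m : R, 0 <= x <= 1 -> 0 <= m <= 1 ->
  [/\ `|f.[m]| <= F, `|f^`().[m]| <= F &
      `|f.[x] - f.[m] - f^`().[m] * (x - m)| <= F * (x - m) ^+ 2].

Definition gap A v : R := f.[frac A v] - f.[mean_frac A v.1].

Let F_ge0 : 0 <= F.
Proof.
have unit_itv0 : 0 <= (0 : R) <= 1 by rewrite lexx ler01.
have [+ _ _] := taylor unit_itv0 unit_itv0.
by apply: le_trans; exact: normr_ge0.
Qed.

Lemma gap_le A v : `|gap A v| <= 2 * F * `|frac A v - mean_frac A v.1|.
Proof.
have x01 := frac_itv A v; have m01 := mean_frac_itv A v.1.
have [_ f'_le f_le] := taylor x01 m01.
set h := frac A v - mean_frac A v.1 in f_le *.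
have h1 : `|h| <= 1 by rewrite /h ler_norml; lra.
have sqr_le : h ^+ 2 <= `|h| by rewrite -(real_normK (num_real h)) expr2 ler_piMl.
rewrite /gap -(subrK (f^`().[mean_frac A v.1] * h) (_ - _)).
apply: le_trans (ler_normD _ _) _; rewrite -mulrA mulr_natl mulr2n normrM.
apply: lerD; last by rewrite ler_wpM2r.
by apply: le_trans f_le _; rewrite ler_wpM2l.
Qed.

Lemma sum_gapE A (T : {set vertex n}) i :
  \sum_(v in T :&: block n i) f_frac (horner f) G A v
      - #|T :&: block n i|%:R * f_mean p q (horner f) A i
    = \sum_(v in T :&: block n i) gap A v.
Proof.
rewrite mulr_natl -sumr_const -sumrB; apply: eq_bigr => v.
by rewrite !inE => /andP[_ /eqP<-].
Qed.

Lemma quasirandom_P2 : P2 p q (horner f) (8 * K * F) G.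
Proof.
move=> A S i; rewrite sum_gapE; apply: le_trans (ler_norm_sum _ _ _) _.
apply: le_trans (ler_sum _ (fun v _ => gap_le A v)) _; rewrite -mulr_sumr.
have -> : 8 * K * F * Num.sqrt (n%:R / p) = 2 * F * (4 * K * Num.sqrt (n%:R / p)).
  by ring.
apply: ler_wpM2l; first by rewrite mulr_ge0.
apply: le_trans (sum_frac_dev_all A).
by rewrite big_mkcond; apply: ler_sum => v _; case: ifP.
Qed.

Lemma gap_set A i : `|\sum_(v in A :&: block n i) gap A v| <= 2 * F * theta * #|A|%:R.
Proof.
apply: le_trans (ler_norm_sum _ _ _) _.
apply: le_trans (ler_sum _ (fun v _ => gap_le A v)) _; rewrite -mulr_sumr -mulrA.
apply: ler_wpM2l; first by rewrite mulr_ge0.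
apply: le_trans (sum_frac_dev_set _ _) _; rewrite ler_pM2l // ler_nat.
by rewrite geq_max leqnn andbT subset_leq_card // finset.subsetIl.
Qed.

(** The constants 5 and 2 come from the quadratic and the linear term of the
    expansion of [f] at the reference value. *)
Lemma gap_block A i : `|\sum_(v in block n i) gap A v| <= 7 * F * theta * #|A|%:R.
Proof.
pose x v := frac A v; pose m := mean_frac A i.
have gapE v : v \in block n i ->
    gap A v = (f.[x v] - f.[m] - f^`().[m] * (x v - m)) + f^`().[m] * (x v - m).
  by rewrite in_block => /eqP vi; rewrite subrK /gap vi.
rewrite (eq_bigr _ gapE) big_split -mulr_sumr /=; apply: le_trans (ler_normD _ _) _.
have m01 := mean_frac_itv A i.
have -> : 7 * F * theta * #|A|%:R = F * (5 * theta * #|A|%:R) + F * (2 * theta * #|A|%:R).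
  by ring.
apply: lerD; last first.
  have [_ f'_le _] := taylor m01 m01.
  rewrite normrM; apply: ler_pM => //.
  apply: le_trans (sum_frac_dev_block A i); rewrite le_eqVlt; apply/orP; left.
  by apply/eqP; congr `|_|; apply: eq_bigr => v; rewrite in_block => /eqP->.
apply: le_trans (ler_norm_sum _ _ _) _.
apply: (@le_trans _ _ (\sum_v F * (x v - mean_frac A v.1) ^+ 2)); last first.
  by rewrite -mulr_sumr ler_wpM2l // sum_frac_dev_sqr.
rewrite big_mkcond; apply: ler_sum => v _.
case: ifP => [|_]; last by rewrite mulr_ge0 ?sqr_ge0.
rewrite in_block => /eqP->.
by have [_ _] := taylor (frac_itv A v) m01.
Qed.

Lemma quasirandom_P3 : P3 p q (horner f) (36 * K * F) G.
Proof.
move=> A S i S_in; rewrite -lerBlDl sum_gapE.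
have -> : 36 * K * F * #|A|%:R * Num.sqrt (L / D) = 9 * F * theta * #|A|%:R.
  have -> : Num.sqrt (L / D) = r / D.
    have -> : L / D = D * L / D ^+ 2 by field; rewrite !lt0r_neq0.
    have L_ge0 : 0 <= D * L by rewrite ltW // -sqrtr_gt0.
    by rewrite sqrtrM // sqrtrV ?sqr_ge0 // sqrtr_sqr ger0_norm // ltW.
  by ring.
have gA := gap_set A i; have gB := gap_block A i.
have c_ge0 : 0 <= F * theta * #|A|%:R by rewrite mulr_ge0 // mulr_ge0 // ltW.
apply: le_trans (ler_norm _) _; move: S_in; rewrite !inE => /or3P[] /eqP->.
- by apply: le_trans gA _; lra.
- have -> : \sum_(v in ~: A :&: block n i) gap A v
      = \sum_(v in block n i) gap A v - \sum_(v in A :&: block n i) gap A v.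
    rewrite [X in _ = X - _](bigID (fun v => v \in A)) /=.
    rewrite [X in _ = X + _ - _](eq_bigl (fun v => v \in A :&: block n i)).
      by rewrite addrAC subrr add0r; apply: eq_bigl => v; rewrite !inE andbC.
    by move=> v; rewrite !inE andbC.
  by apply: le_trans (ler_normB _ _) _; lra.
by rewrite finset.setTI; apply: le_trans gB _; lra.
Qed.

Lemma quasirandom_good : f_good p q (horner f) (8 * K * F) (36 * K * F) G.
Proof.
split; [split | exact: quasirandom_P2 | exact: quasirandom_P3].
- exact: quasirandom_connected.
- exact: quasirandom_not_bipartite.
Qed.

End Deterministic.

(** * Asymptotics *)

Unset Implicit Arguments.

Theorem theorem3p2 (R : realType) (f : {poly R}) (p q : nat -> R)
    (hf : forall x : R, 0 <= x <= 1 -> 0 <= f.[x] <= 1)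
    (hq0 : forall n, 0 <= q n) (hqp : forall n, q n <= p n)
    (hp1 : forall n, p n <= 1)
    (hp : (fun n : nat => ln n%:R / n%:R : R^o) =o_\oo (p : nat -> R^o))
    (hq : \forall n \near \oo, ln n%:R / n%:R ^+ 2 <= q n) :
  exists C1 C2 : R, [/\ 0 < C1, 0 < C2 &
    whp (fun n => sbm_pr (p n) (q n)
           (fun G : graph n => f_good (p n) (q n) (horner f) C1 C2 G))].
Proof.
have [F F_gt0 taylor] := poly_taylor2_itv f.
exists (8 * 50 * F), (36 * 50 * F); split; [by rewrite !mulr_gt0..|].
pose B : R := 2 * expR 4 + 11.
have B_gt0 : 0 < B by have := expR_gt0 (4 : R); rewrite /B; lra.
exists (1 / 2); first by rewrite divr_gt0.
(* The threshold needed by [quasirandom_good] for the constant 50, kept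
   abstract so that it is never computed with in unary. *)
have [N N_eq] : exists N : R, N = 8 * 50 by eexists.
have N_gt0 : 0 < N by rewrite N_eq; lra.
have N2_gt0 : 0 < N ^+ 2 by rewrite exprn_gt0.
have eps_gt0 : 0 < (N ^+ 2)^-1 by rewrite invr_gt0.
have /eqoP/(_ _ eps_gt0) hpE := hp.
(* [B / n] is at most [n `^ (- (1 / 2))] as soon as [expR (L / 2) >= B]. *)
have n_large := nbhs_infty_ger (expR (2 * B + 1)).
near=> n.
have n_ge : expR (2 * B + 1) <= n%:R by near: n.
have n_gt0 : 0 < n%:R :> R by apply: lt_le_trans n_ge; exact: expR_gt0.
have L_ge : 2 * B + 1 <= ln n%:R by rewrite -ler_expR lnK.
have L_ge1 : 1 <= ln n%:R :> R by lra.
have le_LD : N ^+ 2 * ln n%:R <= n%:R * p n.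
  have : `|ln n%:R / n%:R| <= (N ^+ 2)^-1 * `|p n| by near: n.
  have p_ge0 : 0 <= p n by exact: le_trans (hq0 n) (hqp n).
  have L_ge0 : 0 <= ln n%:R :> R by exact: le_trans L_ge1.
  rewrite (ger0_norm p_ge0) ger0_norm ?divr_ge0 //.
  by rewrite ler_pdivrMr // -mulrA ler_pdivlMl // [p n * _]mulrC.
have D_gt0 : 0 < n%:R * p n.
  by apply: lt_le_trans le_LD; rewrite mulr_gt0 // (lt_le_trans ltr01).
have p_gt0 : 0 < p n by rewrite -(pmulr_rgt0 _ n_gt0).
have q_ge : ln n%:R / n%:R ^+ 2 <= q n by near: n.
apply: le_trans (le_trans (pr_quasirandom (hq0 n) (hqp n) (hp1 n) L_ge1 _ q_ge) _).
- rewrite lerD2l lerN2 -/B; pose e : R := expR (1 / 2 * ln n%:R).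
  have -> : n%:R `^ (- (1 / 2)) = e^-1.
    by rewrite /powR gt_eqF // mulNr expRN.
  have -> : n%:R = e * e :> R.
    by rewrite -expRD -mulrDl (_ : 1 / 2 + 1 / 2 = 1) ?mul1r ?lnK //; lra.
  rewrite invfM mulrA ler_piMl ?invr_ge0 ?expR_ge0 //.
  rewrite ler_pdivrMr ?expR_gt0 // mul1r; apply: le_trans (expR_ge1Dx _); lra.
- by apply: le_trans le_LD; rewrite ler_peMl ?(le_trans ler01) // N_eq; lra.
apply: sbm_pr_le => // G GP quasi.
have L_gt0 := lt_le_trans ltr01 L_ge1.
have DL_ge0 : 0 <= n%:R * p n * ln n%:R by apply: mulr_ge0; exact: ltW.
apply: (quasirandom_good n_gt0 p_gt0 (hq0 n) _ _ _ quasi taylor) => //.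
  by rewrite sqrtr_gt0 mulr_gt0.
rewrite -N_eq -ler_sqr ?nnegrE ?(ltW D_gt0) //; last first.
  by rewrite mulr_ge0 ?sqrtr_ge0 // ltW.
by rewrite exprMn sqr_sqrtr // [leRHS]expr2 mulrCA ler_pM2l.
Unshelve. all: by end_near.
Qed.
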